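(* Let $A$ be a finite-dimensional complete left-symmetric algebra over the field $\mathbb{F}=\mathbb{R}$ or $\mathbb{C}$. If $A$ is a derivation algebra or satisfies $(x\cdot y)\cdot z=(y\cdot x)\cdot z$ for all $x,y,z\in A$, then $A$ is not simple.
   Context: A left-symmetric algebra over a field $\mathbb{F}$ is a vector space $A$ over $\mathbb{F}$ with a bilinear product $\cdot$ such that $(x\cdot y)\cdot z-x\cdot(y\cdot z)=(y\cdot x)\cdot z-y\cdot(x\cdot z)$ for all $x,y,z\in A$; it is a derivation algebra if moreover $(x\cdot y)\cdot z=(z\cdot y)\cdot x$ for all $x,y,z\in A$. $A$ is complete if the right multiplication $R_x:y\mapsto y\cdot x$ is nilpotent for every $x\in A$. An algebra $A$ is simple if it is nonzero, has no two-sided ideal other than $\{0\}$ and $A$, and is not the one-dimensional algebra with zero product. *)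

(* Defs.v *)
From HB Require Import structures.
From mathcomp Require Import all_boot all_order all_algebra.
From mathcomp Require Import reals complex.

Set Implicit Arguments.
Unset Strict Implicit.
Unset Printing Implicit Defensive.

Import GRing.Theory.
Local Open Scope ring_scope.

(* MathComp has no non-associative algebras: here an algebra is a vector space
   [A] with a bilinear product [mul]. *)
Section Algebras.
Variables (F : fieldType) (A : vectType F) (mul : {bilinear A -> A -> A}).

Local Notation "x ∘ y" := (mul x y) (at level 40, left associativity).

Definition left_symmetric : Prop :=
  forall x y z : A,
    (x ∘ y) ∘ z - x ∘ (y ∘ z) = (y ∘ x) ∘ z - y ∘ (x ∘ z).

Definition derivation_algebra : Prop :=
  left_symmetric /\ forall x y z : A, (x ∘ y) ∘ z = (z ∘ y) ∘ x.

Definition right_mul (x : A) : A -> A := fun y => y ∘ x.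

Definition nilpotent_map (f : A -> A) : Prop :=
  exists n : nat, forall y : A, iter n f y = 0.

Definition complete_algebra : Prop :=
  forall x : A, nilpotent_map (right_mul x).

Definition two_sided_ideal (I : {vspace A}) : Prop :=
  forall x y : A, y \in I -> (x ∘ y \in I) /\ (y ∘ x \in I).

Definition simple_algebra : Prop :=
  [/\ {:A}%VS != 0%VS,
      forall I : {vspace A}, two_sided_ideal I -> I = 0%VS \/ I = {:A}%VS
    & ~ (\dim {:A} = 1%N /\ forall x y : A, x ∘ y = 0)].

End Algebras.

(* Main.v *)
Require Import Defs.
From HB Require Import structures.
From mathcomp Require Import all_boot all_order all_algebra.
From mathcomp Require Import reals complex.

Set Implicit Arguments.
Unset Strict Implicit.
Unset Printing Implicit Defensive.

Local Open Scope ring_scope.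
Local Open Scope complex_scope.

(* In a simple algebra the ideal A·A is all of A, and nilpotency of R_x keeps
   the subspace A·x proper, so it suffices that A·x is an ideal for every x:
   then all A·x vanish and the product is zero.
   - If (xy)z = (yx)z, left symmetry reads x(yz) = y(xz).  The left annihilator
     is an ideal containing all xy - yx, hence it is zero and A is commutative;
     then (ax)b = b(ax) = x(ba) = (ba)x lies in A·x.
   - If (xy)z = (zy)x, then left symmetry forces
     (((ab)c)d)e = (((ab)c)e)d, so right multiplications commute when A·A = A.
     Then (ax)b = (ab)x and (cd)(ax) = ((ax)d)c = ((ad)c)x lie in A·x. *)

Import GRing.Theory.

Section Ideals.
Variables (F : fieldType) (A : vectType F) (mul : {bilinear A -> A -> A}).

Local Notation "x ∘ y" := (mul x y) (at level 40, left associativity).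

(** Bundled as a linear map, so that A·x is available as the subspace [limg (right_mul_lfun x)]. *)
Definition right_mul_lfun (x : A) : 'Hom(A, A) := linfun (applyr mul x).

Lemma right_mul_lfunE x y : right_mul_lfun x y = y ∘ x.
Proof. by rewrite lfunE. Qed.

Lemma mem_right_image x y : y ∘ x \in limg (right_mul_lfun x).
Proof. by rewrite -right_mul_lfunE memv_img ?memvf. Qed.

Lemma right_imageP x v :
  reflect (exists y, v = y ∘ x) (v \in limg (right_mul_lfun x)).
Proof.
apply: (iffP memv_imgP) => [[y _ ->]|[y ->]].
  by exists y; rewrite right_mul_lfunE.
by exists y; rewrite ?memvf ?right_mul_lfunE.
Qed.

(** A finite sum of the A·e over basis vectors e; by bilinearity it is the span of all products. *)
Definition algebra_square : {vspace A} :=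
  (\sum_(i < \dim {:A}) limg (right_mul_lfun (vbasis {:A})`_i))%VS.

Lemma mem_algebra_square x y : x ∘ y \in algebra_square.
Proof.
rewrite (coord_vbasis (memvf y)) linear_sumr; apply: rpred_sum => i _.
rewrite linearZr_LR; apply: memvZ.
by apply: subvP (mem_right_image _ _); apply: sumv_sup.
Qed.

Lemma algebra_square_ind (U : {vspace A}) :
  (forall x y, x ∘ y \in U) -> (algebra_square <= U)%VS.
Proof.
move=> mulU; apply/subv_sumP => i _; apply/subvP => v /right_imageP[y ->].
exact: mulU.
Qed.

Lemma algebra_square_ideal : two_sided_ideal mul algebra_square.
Proof. by move=> x y _; split; apply: mem_algebra_square. Qed.

Definition left_annihilator : {vspace A} :=
  (\bigcap_(i < \dim {:A}) lker (right_mul_lfun (vbasis {:A})`_i))%VS.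

Lemma left_annihilatorP x :
  reflect (forall y, x ∘ y = 0) (x \in left_annihilator).
Proof.
rewrite memvE; apply: (iffP subv_bigcapP) => [xK y|xK i _]; last first.
  by rewrite -memvE memv_ker right_mul_lfunE xK.
rewrite (coord_vbasis (memvf y)) linear_sumr big1 // => i _.
have := xK i isT; rewrite -memvE memv_ker right_mul_lfunE linearZr_LR /= => /eqP ->.
by rewrite scaler0.
Qed.

(** If R_x were onto, so would be all its iterates, yet one of them is zero. *)
Lemma right_image_proper x :
    {:A}%VS != 0%VS -> nilpotent_map (right_mul mul x) ->
  limg (right_mul_lfun x) <> {:A}%VS.
Proof.
move=> A_neq0 [n nil_n] img_full; case/eqP: A_neq0.
have iter_surj m y : exists z, y = iter m (right_mul mul x) z.
  elim: m y => [|m IHm] y; first by exists y.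
  have /right_imageP[z ->] : y \in limg (right_mul_lfun x).
    by rewrite img_full memvf.
  by have [w ->] := IHm z; exists w.
apply/eqP; rewrite -subv0; apply/subvP => y _.
by have [z ->] := iter_surj n y; rewrite nil_n mem0v.
Qed.

(** With a zero product every line is an ideal, so A would be a line: the excluded algebra. *)
Lemma simple_mul_neq0 :
  simple_algebra mul -> ~ (forall x y, x ∘ y = 0).
Proof.
move=> [A_neq0 simpleA not_dim1] mul0; apply: not_dim1; split=> //.
have v_neq0 : vpick {:A} != 0 by rewrite vpick0.
have [|line0|<-] := simpleA <[vpick {:A}]>%VS.
- by move=> x y _; rewrite !mul0 mem0v.
- by move: v_neq0; rewrite -memv0 -line0 memv_line.
- by rewrite dim_vline v_neq0.
Qed.

Lemma simple_algebra_square :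
  simple_algebra mul -> algebra_square = {:A}%VS.
Proof.
move=> simpleA; have [_ idealA _] := simpleA.
case: (idealA _ algebra_square_ideal) => // sq0.
case: (simple_mul_neq0 simpleA) => x y; apply/eqP.
by rewrite -memv0 -sq0 mem_algebra_square.
Qed.

Lemma complete_right_ideals_not_simple :
    complete_algebra mul ->
    (forall x, two_sided_ideal mul (limg (right_mul_lfun x))) ->
  ~ simple_algebra mul.
Proof.
move=> completeA idealR simpleA; have [A_neq0 idealA _] := simpleA.
apply: (simple_mul_neq0 simpleA) => y x.
have [img0|] := idealA _ (idealR x); last by move/right_image_proper; case.
by apply/eqP; rewrite -memv0 -img0 mem_right_image.
Qed.

(** (ab)(cd) = ((cd)b)a = ((bd)c)a = (ac)(bd). *)
Lemma invertive_medial :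
    (forall x y z, (x ∘ y) ∘ z = (z ∘ y) ∘ x) ->
  forall a b c d, (a ∘ b) ∘ (c ∘ d) = (a ∘ c) ∘ (b ∘ d).
Proof. by move=> invA a b c d; rewrite invA (invA c) invA. Qed.

Lemma derivation_right_mul_comm5 a b c d e :
    derivation_algebra mul ->
  (((a ∘ b) ∘ c) ∘ d) ∘ e = (((a ∘ b) ∘ c) ∘ e) ∘ d.
Proof.
move=> [lsA invA]; have medial := invertive_medial invA.
pose w x y z p q := (((x ∘ y) ∘ z) ∘ p) ∘ q.
pose v x y z p q := ((x ∘ y) ∘ z) ∘ (p ∘ q).
have w13 x y z p q : w x y z p q = w z y x p q by rewrite /w (invA x).
have v13 x y z p q : v x y z p q = v z y x p q by rewrite /v (invA x).
have v34 x y z p q : v x y z p q = v x y p z q by exact: medial.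
(* Left symmetry of [p ∘ z] and [x ∘ y] against [q]; [invA] turns all four terms into left-normed
   words [w]. *)
have E x y z p q :
    w x y z p q = w x y q z p - w p z q y x + w p z y x q.
  have := lsA (p ∘ z) (x ∘ y) q.
  rewrite (invA p z (x ∘ y)) (invA x y (p ∘ z)) (invA p z (_ ∘ q)).
  rewrite (invA x y (_ ∘ q)) -!/(w _ _ _ _ _) => /eqP.
  by rewrite subr_eq => /eqP ->; rewrite -addrA addrC [- _ + _]addrC.
(* Left symmetry of [x], [y], [z], multiplied on the right by [p ∘ q]. *)
have G x y z p q :
    w y z q p x - w x z q p y = v x y z p q - v y x z p q.
  have := congr1 (mul^~ (p ∘ q)) (lsA x y z).
  rewrite /= !linearBl /= (invA x (y ∘ z)) (invA y (x ∘ z)).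
  rewrite (invA p q (y ∘ z)) (invA p q (x ∘ z)) -!/(w _ _ _ _ _).
  rewrite -!/(v _ _ _ _ _) => /eqP; rewrite subr_eq => /eqP ->.
  by rewrite addrAC [v y _ _ _ _ - _]addrC addrK addrC.
(* [P x y z] is ((de - ed)x)(yz). *)
pose P x y z := v d e x y z - v e d x y z.
have P12 x y z : P x y z = P y x z by rewrite /P (v34 d) (v34 e).
(* Expand both words by [E]: the middle terms cancel by [w13], and [G] turns the other four into two
   values of [P]. *)
have D x y z : w x y z d e - w x y z e d = P y z x - P z x y.
  rewrite (E _ _ _ d) (E _ _ _ e) (w13 d z e) opprD addrACA opprB subrKA.
  rewrite (w13 x y e) (w13 x y d) !G.
  by rewrite /P opprB.
(* The left-hand side of [D] is symmetric in [x] and [z]; hence [P] is totally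
   symmetric and the right-hand side vanishes. *)
have P23 x y z : P x y z = P x z y.
  by have := D z x y; rewrite !(w13 z) D (P12 z) => /addIr.
apply/eqP; rewrite -subr_eq0 -/(w a b c d e) -/(w a b c e d) D.
by rewrite P12 P23 subrr.
Qed.

Lemma derivation_right_mul_comm :
    derivation_algebra mul -> algebra_square = {:A}%VS ->
  forall x y z, (x ∘ y) ∘ z = (x ∘ z) ∘ y.
Proof.
move=> derA sqA x y z.
pose f : 'Hom(A, A) := (right_mul_lfun z \o right_mul_lfun y)%VF
                       - (right_mul_lfun y \o right_mul_lfun z)%VF.
have fE u : f u = (u ∘ y) ∘ z - (u ∘ z) ∘ y.
  by rewrite /f add_lfunE opp_lfunE !comp_lfunE !right_mul_lfunE.
(* The hypothesis A·A = A is used twice: here to take [u] as a product, below to take [x] as one. *)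
have f0 u v : f (u ∘ v) = 0.
  rewrite -right_mul_lfunE -comp_lfunE; apply/eqP; rewrite -memv_ker.
  apply: subvP (memvf u); rewrite -sqA; apply: algebra_square_ind => a b.
  rewrite memv_ker comp_lfunE right_mul_lfunE fE subr_eq0; apply/eqP.
  exact: derivation_right_mul_comm5.
apply/eqP; rewrite -subr_eq0 -fE -memv_ker.
apply: subvP (memvf x); rewrite -sqA; apply: algebra_square_ind => u v.
by rewrite memv_ker f0.
Qed.

Lemma derivation_right_image_ideal x :
    derivation_algebra mul -> algebra_square = {:A}%VS ->
  two_sided_ideal mul (limg (right_mul_lfun x)).
Proof.
move=> derA sqA b _ /right_imageP[a ->].
have mulAC := derivation_right_mul_comm derA sqA.
split; last by rewrite mulAC mem_right_image.
(* Membership of b(ax) in A·x is a linear condition on [b], so it is enough to check products b =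
   cd. *)
suff sub : (algebra_square
    <= linfun (applyr mul (a ∘ x)) @^-1: limg (right_mul_lfun x))%VS.
  by have := subvP sub b; rewrite sqA memvf -memv_preim lfunE; apply.
apply: algebra_square_ind => c d; rewrite -memv_preim lfunE /=.
by rewrite (derA.2 c d) (mulAC a) (mulAC _ x) mem_right_image.
Qed.

(** If y annihilates A from the left, then yx = 0 and (xy)z = (yx)z = 0. *)
Lemma left_annihilator_ideal :
    (forall x y z, (x ∘ y) ∘ z = (y ∘ x) ∘ z) ->
  two_sided_ideal mul left_annihilator.
Proof.
move=> commL x y /left_annihilatorP y0.
split; apply/left_annihilatorP => z; first rewrite commL;
  by rewrite y0 linear0l.
Qed.

Lemma simple_left_commutator_comm :
    (forall x y z, (x ∘ y) ∘ z = (y ∘ x) ∘ z) ->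
  simple_algebra mul -> forall x y, x ∘ y = y ∘ x.
Proof.
move=> commL simpleA x y; have [_ idealA _] := simpleA.
case: (idealA _ (left_annihilator_ideal commL)) => [ann0|annA].
  apply/eqP; rewrite -subr_eq0 -memv0 -ann0; apply/left_annihilatorP => z.
  by rewrite linearBl commL subrr.
case: (simple_mul_neq0 simpleA) => u v.
by apply: (left_annihilatorP u _); rewrite annA memvf.
Qed.

End Ideals.

Theorem proposition38 (R : realType) (F : fieldType)
  (F_R_or_C : F = (R : fieldType) \/ F = (R[i] : fieldType))
  (A : vectType F) (mul : {bilinear A -> A -> A})
  (mul_lsa : left_symmetric mul) (mul_complete : complete_algebra mul)
  (mul_cases : derivation_algebra mul \/
     (forall x y z : A, mul (mul x y) z = mul (mul y x) z)) :
  ~ simple_algebra mul.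
Proof.
move=> simpleA; apply: (complete_right_ideals_not_simple mul_complete) (simpleA).
case: mul_cases => [derA|commL] x.
  exact: derivation_right_image_ideal derA (simple_algebra_square simpleA).
have mulC := simple_left_commutator_comm commL simpleA.
have mulCA a b c : mul a (mul b c) = mul b (mul a c).
  by have := mul_lsa a b c; rewrite commL => /addrI /oppr_inj.
move=> b _ /right_imageP[a ->].
(* By commutativity both conditions concern b(ax) = b(xa) = x(ba) = (ba)x. *)
by split; last rewrite mulC; rewrite (mulC a) mulCA mulC mem_right_image.
Qed.
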